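(* Let $P$ be a poset and $\mathcal I\subset\mathcal J\subset\mathrm{Int}(P)$. Assume that the GRIs of the $P$-modules $M$ and $N$ are convolvable over $\mathcal J$. Then $\mathrm{rk}_M^{\mathcal J}$ and $\mathrm{rk}_N^{\mathcal J}$ coincide on $\mathcal I$ if and only if $\mathrm{dgm}_M^{\mathcal J}-\mathrm{dgm}_N^{\mathcal J}$ is a linear combination of the Möbius inversions over $\mathcal J$, $\mathbf 1_I*\mu_{\mathcal J}$, of the indicators $\mathbf 1_I$ for $I\in\mathcal J\setminus\mathcal I$.
   Context: Fix a field $k$; $\mathbf{vec}$ is the category of finite-dimensional $k$-vector spaces. A poset $P$ is regarded as a category. A $P$-module is a functor $M:P\to\mathbf{vec}$. An interval of $P$ is a nonempty $I\subset P$ that is convex ($p,r\in I$, $p\le q\le r$ imply $q\in I$) and connected (any two elements of $I$ are joined by a finite sequence in $I$ whose consecutive elements are comparable). $\mathrm{Int}(P)$ is the set of intervals of $P$. For a connected poset $P$ and a $P$-module $M$, $\mathrm{rk}(M)$ is the rank of the canonical map $\varprojlim M\to\varinjlim M$, namely $i_p\circ\pi_p$ for any $p\in P$ ($\pi_p,i_p$ the structure maps). The GRI of $M$ over $\mathcal J\subset\mathrm{Int}(P)$ is $\mathrm{rk}_M^{\mathcal J}:\mathcal J\to\mathbb Z_{\ge0}$, $I\mapsto\mathrm{rk}(M|_I)$. Any $\mathcal J\subset\mathrm{Int}(P)$ is ordered by containment $\supset$ (so $J$ is below $I$ iff $J\supset I$). It is locally finite if for all $J\supset I$ in $\mathcal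 J$ there are finitely many $K\in\mathcal J$ with $J\supset K\supset I$. For $\mathcal J$ locally finite, a function $f$ on $\mathcal J$ is convolvable if for every $I\in\mathcal J$, $f(J)=0$ for all but finitely many $J\in\mathcal J$ with $J\supset I$; the Möbius inversion of a convolvable $f$ over $\mathcal J$ is $f*\mu_{\mathcal J}$, $(f*\mu_{\mathcal J})(I)=\sum_{J\supset I,\,J\in\mathcal J}f(J)\,\mu_{\mathcal J}(J,I)$, where $\mu_{\mathcal J}$ is the Möbius function of $(\mathcal J,\supset)$. ''The GRI of $M$ is convolvable over $\mathcal J$'' means that $\mathcal J$ is locally finite and $\mathrm{rk}_M^{\mathcal J}$ is convolvable; then the generalized persistence diagram of $M$ over $\mathcal J$ is $\mathrm{dgm}_M^{\mathcal J}:=\mathrm{rk}_M^{\mathcal J}*\mu_{\mathcal J}$. For $I\in\mathcal J$, $\mathbf 1_I:\mathcal J\to\{0,1\}$ is the indicator function of $\{I\}$. All functions are viewed in the $\mathbb Q$-vector space of convolvable functions $\mathcal J\to\mathbb Q$, and linear combinations are taken there.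
   Formalization: ''Linear combination'' is read as a possibly infinite, locally finite one (for each interval, only finitely many terms are nonzero somewhere on the members of 𝒥 containing it), since with finite linear combinations the ''only if'' direction fails when 𝒥∖ℐ is infinite. *)

(* Defs.v *)
From HB Require Import structures.
From mathcomp Require Export all_boot all_order all_algebra.
From mathcomp Require Export mathcomp_extra boolp classical_sets functions.
From mathcomp Require Export cardinality fsbigop.
From mathcomp Require Import finmap generic_quotient ring_quotient.

Set Implicit Arguments.
Unset Strict Implicit.
Unset Printing Implicit Defensive.

Import Order.TTheory GRing.Theory Num.Theory.
Local Open Scope classical_set_scope.
Local Open Scope ring_scope.
Import Order.POrderTheory.

(** * Products, direct sums and quotients of vector spaces *)

Section Product.
Variables (k : fieldType) (X : Type) (V : X -> lmodType k).

Definition dprod : Type := forall x, V x.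

HB.instance Definition _ := gen_eqMixin dprod.
HB.instance Definition _ := gen_choiceMixin dprod.

Implicit Types f g : dprod.

Fact dprod_addA : associative (fun f g : dprod => (fun x => f x + g x) : dprod).
Proof. by move=> f g h; apply: functional_extensionality_dep => x; rewrite addrA. Qed.
Fact dprod_addC : commutative (fun f g : dprod => (fun x => f x + g x) : dprod).
Proof. by move=> f g; apply: functional_extensionality_dep => x; rewrite addrC. Qed.
Fact dprod_add0 :
  left_id ((fun x => 0) : dprod) (fun f g : dprod => (fun x => f x + g x) : dprod).
Proof. by move=> f; apply: functional_extensionality_dep => x; rewrite add0r. Qed.
Fact dprod_addN : left_inverse ((fun x => 0) : dprod)
  (fun f : dprod => (fun x => - f x) : dprod)
  (fun f g : dprod => (fun x => f x + g x) : dprod).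
Proof. by move=> f; apply: functional_extensionality_dep => x; rewrite addNr. Qed.

HB.instance Definition _ := GRing.isZmodule.Build dprod
  dprod_addA dprod_addC dprod_add0 dprod_addN.

Definition dprod_scale (a : k) f : dprod := fun x => a *: f x.

Fact dprod_scaleA a b f : dprod_scale a (dprod_scale b f) = dprod_scale (a * b) f.
Proof. by apply: functional_extensionality_dep => x; rewrite /dprod_scale scalerA. Qed.
Fact dprod_scale1 : left_id 1 dprod_scale.
Proof. by move=> f; apply: functional_extensionality_dep => x; rewrite /dprod_scale scale1r. Qed.
Fact dprod_scaleDr : right_distributive dprod_scale +%R.
Proof. by move=> a f g; apply: functional_extensionality_dep => x; exact: scalerDr. Qed.
Fact dprod_scaleDl f : {morph dprod_scale^~ f : a b / a + b}.
Proof. by move=> a b; apply: functional_extensionality_dep => x; exact: scalerDl. Qed.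

HB.instance Definition _ := GRing.Zmodule_isLmodule.Build k dprod
  dprod_scaleA dprod_scale1 dprod_scaleDr dprod_scaleDl.

End Product.

Section Subspaces.
Variables (k : fieldType) (U : lmodType k).

Definition is_subspace (S : set U) : Prop :=
  S 0 /\ forall (a : k) (u v : U), S u -> S v -> S (a *: u + v).

Definition lspan (G : set U) : set U :=
  [set u | forall S, is_subspace S -> G `<=` S -> S u].

Definition lspan_pred (G : set U) : {pred U} := fun u => `[< lspan G u >].

Fact lspan_subspace G : is_subspace (lspan G).
Proof.
split=> [S [] //|a u v su sv S Ssub GS].
by apply: Ssub.2; [exact: su | exact: sv].
Qed.

Fact lspan_submod_closed G : submod_closed (lspan_pred G).
Proof.
have [s0 sD] := lspan_subspace G; split; first exact/asboolP.
by move=> a u v /asboolP su /asboolP sv; apply/asboolP; exact: sD.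
Qed.

HB.instance Definition _ G :=
  GRing.isSubmodClosed.Build k U (lspan_pred G) (lspan_submod_closed G).

End Subspaces.

Import Quotient.Exports.
Section QuotientSpace.
Variables (k : fieldType) (U : lmodType k) (G : set U).

Definition qspace : Type := Quotient.quot (lspan_pred G).
HB.instance Definition _ := GRing.Zmodule.on qspace.

Definition qproj (u : U) : qspace := \pi_(Quotient.quot (lspan_pred G))%qT u.

Fact qprojE u v : (qproj u = qproj v) <-> (lspan G (u - v)).
Proof.
rewrite /qproj; split => [e|h].
  apply/asboolP; rewrite -[X in is_true X]/(u - v \in lspan_pred G).
  by rewrite Quotient.idealrBE e.
by apply/eqP; rewrite -Quotient.idealrBE; apply/asboolP.
Qed.

Fact qprojD u v : qproj (u + v) = qproj u + qproj v.
Proof. by rewrite /qproj (@Quotient.pi_add U (lspan_pred G)). Qed.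

Definition qscale (a : k) (x : qspace) : qspace := qproj (a *: repr x).

Fact qprojK (x : qspace) : qproj (repr x) = x. Proof. exact: reprK. Qed.

Fact qscaleE a u : qscale a (qproj u) = qproj (a *: u).
Proof. by apply/qprojE; rewrite -scalerBr -[_ *: _]addr0;
  apply: (lspan_subspace G).2 (lspan_subspace G).1; apply/qprojE; rewrite qprojK. Qed.

Fact qscaleA a b x : qscale a (qscale b x) = qscale (a * b) x.
Proof. by rewrite -[x]qprojK !qscaleE scalerA. Qed.
Fact qscale1 : left_id 1 qscale.
Proof. by move=> x; rewrite -[x]qprojK !qscaleE scale1r. Qed.
Fact qscaleDr : right_distributive qscale +%R.
Proof.
by move=> a x y; rewrite -[x]qprojK -[y]qprojK -qprojD !qscaleE scalerDr qprojD.
Qed.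
Fact qscaleDl x : {morph qscale^~ x : a b / a + b}.
Proof. by move=> a b; rewrite -[x]qprojK !qscaleE scalerDl qprojD. Qed.

HB.instance Definition _ := GRing.Zmodule_isLmodule.Build k qspace
  qscaleA qscale1 qscaleDr qscaleDl.

Fact qproj_linear : linear qproj.
Proof. by move=> a u v; rewrite qprojD -qscaleE. Qed.
HB.instance Definition _ := GRing.isLinear.Build k U qspace *:%R qproj qproj_linear.

End QuotientSpace.

Section DirectSum.
Variables (k : fieldType) (X : choiceType) (V : X -> lmodType k).

Definition dsum_pred : {pred dprod V} :=
  fun f => `[< finite_set [set x | f x != 0] >].

Fact dsum_submod_closed : submod_closed dsum_pred.
Proof.
split=> [|a f g /asboolP ff /asboolP gf]; apply/asboolP.
  by apply: (sub_finite_set _ (finite_set0 X)) => x /=; rewrite eqxx.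
apply: (sub_finite_set _ (_ : finite_set ([set x | f x != 0] `|` [set x | g x != 0]))).
  move=> x /=; have [f0|] := eqVneq (f x) 0; last by left.
  have [g0|] := eqVneq (g x) 0; last by right.
  by have -> : (a *: f + g) x = a *: f x + g x by []; rewrite f0 g0 scaler0 addr0 eqxx.
by rewrite finite_setU.
Qed.

HB.instance Definition _ :=
  GRing.isSubmodClosed.Build k (dprod V) dsum_pred dsum_submod_closed.

Definition dsum : Type := {f : dprod V | f \in dsum_pred}.
HB.instance Definition _ := SubChoice.on dsum.
HB.instance Definition _ := [SubChoice_isSubLmodule of dsum by <:].

Fact dsum_in_subproof x (v : V x) : (dfwith (fun=> 0) x v : dprod V) \in dsum_pred.
Proof.
apply/asboolP; apply: (sub_finite_set _ (finite_set1 x)) => y /=.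
by case: dfwithP => [//|z _]; rewrite eqxx.
Qed.

Definition dsum_in x (v : V x) : dsum :=
  exist (fun f : dprod V => f \in dsum_pred) _ (dsum_in_subproof v).

Fact dsum_in_linear x : linear (@dsum_in x).
Proof.
move=> a u v; apply: val_inj; rewrite linearP /=.
apply: functional_extensionality_dep => y.
have E (f g : dprod V) : (a *: f + g) y = a *: f y + g y by [].
rewrite E; have [->|ne] := eqVneq y x; first by rewrite !dfwithin.
by rewrite !dfwithout ?scaler0 ?addr0 // eq_sym.
Qed.
HB.instance Definition _ x :=
  GRing.isLinear.Build k (V x) dsum *:%R (@dsum_in x) (@dsum_in_linear x).

End DirectSum.

(** * Rank of a linear map *)

Section Rank.
Variables (k : fieldType) (U V : lmodType k).

Definition lin_indep n (v : 'I_n -> V) : Prop :=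
  forall c : 'I_n -> k, \sum_i c i *: v i = 0 -> forall i, c i = 0.

Definition is_lrank (f : {linear U -> V}) (n : nat) : Prop :=
  (exists u : 'I_n -> U, lin_indep (f \o u)) /\
  forall m (u : 'I_m -> U), lin_indep (f \o u) -> (m <= n)%N.

(* The dimension of the image of [f], i.e. the largest size of an independent
   family in that image; by convention 0 if the image is infinite-dimensional. *)
Definition lrank (f : {linear U -> V}) : nat := xget 0%N [set n | is_lrank f n].

(* No junk value as soon as [f] factors through a finite-dimensional space. *)
Lemma lrankP (W : vectType k) (h : {linear U -> W}) (g : {linear W -> V})
    (f : {linear U -> V}) :
  (forall u, f u = g (h u)) -> is_lrank f (lrank f).
Proof.
move=> fE; pose Q n := `[< exists u : 'I_n -> U, lin_indep (f \o u) >].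
have Q0 : exists n, Q n.
  by exists 0%N; apply/asboolP; exists (fun=> 0) => c _ [].
have Qb n : Q n -> (n <= \dim {:W})%N.
  move=> /asboolP[u uI]; pose X := [tuple h (u i) | i < n].
  have Xf : free X.
    apply/freeP => c c0 i; apply: (uI c) => /=.
    transitivity (g (\sum_(i < n) c i *: X`_i)); last by rewrite c0 linear0.
    rewrite linear_sum; apply: eq_bigr => j _.
    by rewrite linearZ /= fE (nth_map j) ?size_enum_ord // nth_ord_enum.
  have := dimvS (subvf <<X>>%VS); rewrite (eqP Xf).
  by rewrite size_tuple.
have rkE : is_lrank f (ex_maxn Q0 Qb).
  case: ex_maxnP => n /asboolP Qn nmax; split=> // m u uI.
  by apply: nmax; apply/asboolP; exists u.
exact: (xgetPex 0%N (ex_intro [set n | is_lrank f n] _ rkE)).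
Qed.

End Rank.

(** * Modules over a poset, limits and colimits *)

Record pmodule (k : fieldType) (d : Order.disp_t) (P : porderType d) := PModule {
  pm_obj :> P -> vectType k;
  pm_map : forall p q : P, (p <= q)%O -> {linear pm_obj p -> pm_obj q};
  pm_map_id : forall (p : P) (h : (p <= p)%O) v, pm_map h v = v;
  pm_map_comp : forall (p q r : P) (hpq : (p <= q)%O) (hqr : (q <= r)%O)
    (hpr : (p <= r)%O) v, pm_map hpr v = pm_map hqr (pm_map hpq v) }.

Section LimitColimit.
Variables (k : fieldType) (d : Order.disp_t) (P : porderType d).
Variable M : pmodule k P.

Let V (p : P) : lmodType k := M p.

Definition lim_pred : {pred dprod V} :=
  fun s => `[< forall (p q : P) (h : (p <= q)%O), pm_map M h (s p) = s q >].

Fact lim_submod_closed : submod_closed lim_pred.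
Proof.
split=> [|a s t /asboolP sc /asboolP tc]; apply/asboolP => p q h.
  exact: linear0.
have E x : (a *: s + t) x = a *: s x + t x by [].
by rewrite !E linearP /= sc tc.
Qed.

HB.instance Definition _ :=
  GRing.isSubmodClosed.Build k (dprod V) lim_pred lim_submod_closed.

Definition plim : Type := {s : dprod V | s \in lim_pred}.
HB.instance Definition _ := SubChoice.on plim.
HB.instance Definition _ := [SubChoice_isSubLmodule of plim by <:].

Definition plim_proj (p : P) (s : plim) : V p := (\val s : dprod V) p.

Fact plim_proj_linear p : linear (@plim_proj p).
Proof. by move=> a s t; rewrite /plim_proj linearP. Qed.
HB.instance Definition _ p :=
  GRing.isLinear.Build k plim (V p) *:%R (@plim_proj p) (@plim_proj_linear p).

Definition colim_rel : set (dsum V) :=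
  [set w | exists (p q : P) (h : (p <= q)%O) (v : V p),
     w = dsum_in v - dsum_in (pm_map M h v : V q)].

Definition pcolim : lmodType k := qspace colim_rel.

Definition pcolim_in (p : P) (v : V p) : pcolim := qproj colim_rel (dsum_in v).

Fact pcolim_in_linear p : linear (@pcolim_in p).
Proof. by move=> a u v; rewrite /pcolim_in !linearP. Qed.
HB.instance Definition _ p :=
  GRing.isLinear.Build k (V p) pcolim *:%R (@pcolim_in p) (@pcolim_in_linear p).

Definition lim_to_colim (p : P) : {linear plim -> pcolim} :=
  @pcolim_in p \o @plim_proj p.

(* The rank of the canonical map; see [lim_to_colim_const] below for the
   independence of [p] when [P] is connected. *)
Definition rk (p : P) : nat := lrank (lim_to_colim p).

Lemma rkP (p : P) : is_lrank (lim_to_colim p) (rk p).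
Proof. exact: (@lrankP _ _ _ (M p) (@plim_proj p) (@pcolim_in p)). Qed.

Lemma lim_to_colim_le (p q : P) : (p <= q)%O ->
  lim_to_colim p =1 lim_to_colim q.
Proof.
move=> h s /=; apply/qprojE => S _ GS; apply: GS.
exists p, q, h, (plim_proj p s); congr (_ - dsum_in _).
by have /asboolP/(_ p q h) := valP s.
Qed.

End LimitColimit.

(** * Subposets and intervals *)

Section Subposet.
Variables (d : Order.disp_t) (P : porderType d) (A : set P).
HB.instance Definition _ := SubChoice.on (set_type A).
HB.instance Definition _ := [SubChoice_isSubPOrder of set_type A by <: with d].
End Subposet.

Section Restriction.
Variables (k : fieldType) (d : Order.disp_t) (P : porderType d).
Variables (M : pmodule k P) (A : set P).

Definition restrict : pmodule k A :=
  @PModule k d A (fun p => M (val p)) (fun p q h => @pm_map _ _ _ M (val p) (val q) h)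
    (fun p h => @pm_map_id _ _ _ M (val p) h)
    (fun p q r => @pm_map_comp _ _ _ M (val p) (val q) (val r)).

End Restriction.

Section PosetInterval.
Variables (d : Order.disp_t) (P : porderType d).

Definition order_convex (A : set P) : Prop :=
  forall p q r, A p -> A r -> (p <= q)%O -> (q <= r)%O -> A q.

Definition order_connected (A : set P) : Prop :=
  forall p q, A p -> A q -> exists s : seq P,
    [/\ forall x, x \in s -> A x, path (fun x y => (x >=< y)%O) p s & last p s = q].

Record poset_interval := PosetInterval {
  ival :> set P;
  ival_neq0 : ival !=set0;
  ival_convex : order_convex ival;
  ival_connected : order_connected ival }.

HB.instance Definition _ := gen_eqMixin poset_interval.
HB.instance Definition _ := gen_choiceMixin poset_interval.

Lemma ival_inj : injective ival.
Proof.
case=> [A a b c] [B a' b' c'] /= AB; case: B / AB a' b' c' => a' b' c'.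
by rewrite (Prop_irrelevance a a') (Prop_irrelevance b b') (Prop_irrelevance c c').
Qed.

(* Reverse containment: [J <= I] iff [J] contains [I]. *)
Definition ile (J I : poset_interval) : bool := `[< ival I `<=` ival J >].

Fact ile_refl : reflexive ile. Proof. by move=> I; apply/asboolP. Qed.
Fact ile_anti : antisymmetric ile.
Proof.
by move=> I J /andP[/asboolP JI /asboolP IJ]; apply: ival_inj; apply/seteqP.
Qed.
Fact ile_trans : transitive ile.
Proof.
by move=> J I K /asboolP JI /asboolP KJ; apply/asboolP => p /KJ /JI.
Qed.

HB.instance Definition _ := Order.Le_isPOrder.Build Order.default_display poset_interval
  ile_refl ile_anti ile_trans.

Definition ival_point (I : poset_interval) : ival I :=
  let: exist p Ip := cid (ival_neq0 I) in exist _ p (mem_set Ip).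

End PosetInterval.

Lemma lim_to_colim_const (k : fieldType) (d : Order.disp_t) (P : porderType d)
    (M : pmodule k P) (I : poset_interval P) (p q : ival I) :
  lim_to_colim (restrict M I) p =1 lim_to_colim (restrict M I) q.
Proof.
have Iq := set_mem (valP q).
have [s [sI sp slast]] := ival_connected (set_mem (valP p)) Iq.
elim: s p sI sp slast => [|x s IHs] p sI /=.
  by move=> _ pq; have -> : p = q by exact: val_inj.
move=> /andP[px xs] xq; have Ix : ival I x by apply: sI; rewrite mem_head.
pose x' : ival I := exist _ x (mem_set Ix).
move=> t; rewrite -(IHs x' _ xs xq); last by move=> y ys; apply: sI; rewrite in_cons ys orbT.
have [le|le] := orP px; first exact: (@lim_to_colim_le _ _ _ (restrict M I) p x' le).
by rewrite (@lim_to_colim_le _ _ _ (restrict M I) x' p le).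
Qed.

(** * Möbius inversion on a poset *)

Section Moebius.
Variables (d : Order.disp_t) (T : porderType d).
Implicit Types (x y z : T) (f g : T -> rat).

Definition locally_finite : Prop :=
  forall x y, finite_set [set z | (x <= z)%O && (z <= y)%O].

Definition convolvable f : Prop :=
  forall y, finite_set [set x | (x <= y)%O && (f x != 0)].

(* [n] bounds the depth of the recursion; [mobius] below runs it with the
   cardinal of the half-open interval, which suffices by [mobius_lt]. *)
Fixpoint mobius_rec n x y : rat :=
  if x == y then 1 else
  if n is n'.+1 then
    - \sum_(z \in [set z | (x <= z)%O && (z < y)%O]) mobius_rec n' x z
  else 0.

Definition mobius x y : rat :=
  mobius_rec #|` fset_set [set z | (x <= z)%O && (z < y)%O]| x y.

Lemma mobius_refl x : mobius x x = 1.
Proof. by rewrite /mobius; case: #|` _| => [|n] /=; rewrite eqxx. Qed.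

Lemma mobius_nle x y : ~~ (x <= y)%O -> mobius x y = 0.
Proof.
move=> xy; have xny : (x == y) = false by apply/negP => /eqP e; rewrite e lexx in xy.
rewrite /mobius; case: #|` _| => [|n] /=; rewrite xny//.
rewrite (_ : [set z | _] = set0) ?fsbig_set0 ?oppr0//.
by apply/seteqP; split=> // z /= /andP[xz /ltW zy]; rewrite (le_trans xz zy) in xy.
Qed.

Lemma mobius_lt x y : locally_finite -> (x < y)%O ->
  mobius x y = - \sum_(z \in [set z | (x <= z)%O && (z < y)%O]) mobius x z.
Proof.
move=> lf; pose S y := [set z | (x <= z)%O && (z < y)%O].
have Sfin z : finite_set (S z).
  by apply: sub_finite_set (lf x z) => w /= /andP[-> /ltW].
have Slt z w : S w z -> (#|` fset_set (S z)| < #|` fset_set (S w)|)%N.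
  move=> /= /andP[xz zw]; apply: fproper_ltn_card.
  rewrite fproperE; apply/andP; split.
    apply/fsubsetP => v; rewrite !in_fset_set// => /set_mem /= /andP[xv vz].
    by apply/mem_set; rewrite /S /= xv (lt_trans vz zw).
  apply/negP => /fsubsetP/(_ z); rewrite !in_fset_set//.
  have zS : z \in S w by apply/mem_set; rewrite /S /= xz zw.
  by move=> /(_ zS) /set_mem; rewrite /S /= ltxx andbF.
have recE n m z : (#|` fset_set (S z)| <= n)%N -> (#|` fset_set (S z)| <= m)%N ->
    mobius_rec n x z = mobius_rec m x z.
  have Slt0 w : (#|` fset_set (S w)| <= 0)%N -> S w = set0.
    rewrite leqn0 cardfs_eq0 => /eqP e; rewrite -[S w]fset_setK // e.
    by apply/seteqP; split.
  elim: n m z => [|n IHn] [|m] z //= hn hm; case: eqP => // _.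
  - by rewrite -/(S z) Slt0// fsbig_set0 oppr0.
  - by rewrite -/(S z) Slt0// fsbig_set0 oppr0.
  congr (- _); apply: eq_fsbigr => w /set_mem Sw.
  by apply: IHn; rewrite -ltnS (leq_trans (Slt _ _ Sw)).
move=> xy; rewrite {1}/mobius -/(S y).
have Sx : S y x by rewrite /S /= lexx xy.
have := Slt _ _ Sx; case E : #|` fset_set (S y)| => [//|n] _ /=.
rewrite lt_eqF//; congr (- _); apply: eq_fsbigr => w /set_mem Sw.
by apply: recE; rewrite // -ltnS -E Slt.
Qed.

Definition mobius_inversion f : T -> rat :=
  fun y => \sum_(x \in [set x | (x <= y)%O]) f x * mobius x y.

Definition indic x : T -> rat := fun y => (y == x)%:R.

(* Linear combinations in the space of convolvable functions. The family may be
   infinite, as the functions involved need not have finite support. It is then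
   required to be locally finite: for each [y], all but finitely many terms
   vanish identically on the down-set of [y]. The pointwise sums are then finite
   and define a convolvable function (pointwise finiteness alone would not be
   enough). Finite linear combinations are a special case. *)
Definition linear_combination (X : choiceType) (D : set X) (g : X -> T -> rat)
    (h : T -> rat) : Prop :=
  exists c : X -> rat,
    (forall y, finite_set
       [set i | D i /\ exists2 x, (x <= y)%O & c i * g i x != 0]) /\
    h = (fun y => \sum_(i \in D) c i * g i y).

Lemma finite_linear_combination (X : choiceType) (D : set X) (g : X -> T -> rat)
    (c : X -> rat) : finite_set [set i | D i /\ c i != 0] ->
  linear_combination D g (fun y => \sum_(i \in D) c i * g i y).
Proof.
move=> cfin; exists c; split=> // y; apply: sub_finite_set cfin => i /=.
by move=> [Di [x _ cg]]; split=> //; apply: contra_neq cg => ->; rewrite mul0r.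
Qed.

Lemma linear_combination_convolvable (X : choiceType) (D : set X)
    (g : X -> T -> rat) (h : T -> rat) :
  (forall i, D i -> convolvable (g i)) -> linear_combination D g h ->
  convolvable h.
Proof.
move=> gc [c [cfin ->]] y.
pose F := [set i | D i /\ exists2 x, (x <= y)%O & c i * g i x != 0].
apply: (@sub_finite_set _ _
  (\bigcup_(i in F) [set x | (x <= y)%O && (g i x != 0)])); last first.
  by apply: bigcup_finite => [|i [Di _]]; [exact: cfin | exact: gc].
move=> x /= /andP[xy]; apply: contraPP => nx; apply/negP; rewrite negbK.
rewrite fsbig1// => i Di; apply: contra_notP nx => /eqP cg.
exists i; first by split=> //; exists x.
by rewrite /= xy; apply: contra_neq cg => ->; rewrite mulr0.
Qed.

End Moebius.

(** * Generalized rank invariant and generalized persistence diagram *)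

Section GRI.
Variables (k : fieldType) (d : Order.disp_t) (P : porderType d).
Variables (J : set (poset_interval P)) (M : pmodule k P).

Lemma ileP (A B : J) :
  (A <= B)%O <-> (ival (val B) `<=` ival (val A)).
Proof. by split=> /asboolP. Qed.

Definition gri (I : J) : nat := rk (restrict M (val I)) (ival_point (val I)).

Definition griQ : J -> rat := fun I => (gri I)%:R.

Definition gri_convolvable : Prop :=
  locally_finite (set_type J) /\ convolvable griQ.

Definition dgm : J -> rat := mobius_inversion griQ.

End GRI.

(* Main.v *)
(** For fixed [A], Möbius inversion sends the indicator of [A] to [B |-> mu(A, B)],
    so a locally finite combination of such functions with coefficients [c] is the
    Möbius inversion of [c]. The theorem then follows from the injectivity of
    Möbius inversion on convolvable functions, applied to [rk_M - rk_N]: if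
    [(f * mu)(y) = 0] and [f] vanishes strictly below [y], then
    [f y = (f * mu)(y) = 0]; convolvability makes this induction well-founded. *)
Require Import Defs.
From mathcomp Require Import all_boot all_order all_algebra finmap.
From mathcomp Require Import boolp classical_sets functions cardinality fsbigop.
Import Order.TTheory GRing.Theory Num.Theory.
Local Open Scope classical_set_scope.
Local Open Scope ring_scope.

Section MobiusInversion.
Context {d : Order.disp_t} {T : porderType d}.
Implicit Types (x y : T) (f g : T -> rat).

Lemma mobius_inversion_indic x : mobius_inversion (indic x) = mobius x.
Proof.
apply/funext => y; rewrite /mobius_inversion.
have [xy|xy] := boolP (x <= y)%O.
  rewrite -(@fsbig_widen _ _ _ _ [set x]).
  - by rewrite fsbig_set1 /indic eqxx mul1r.
  - by move=> z /= ->.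
  - by move=> z /= [_ /eqP/negPf zx]; rewrite /indic zx mul0r.
rewrite mobius_nle// fsbig1// => z /= zy; rewrite /indic.
by have [zx|_] := eqVneq z x; [rewrite -zx zy in xy | rewrite mul0r].
Qed.

Lemma convolvableB f g :
  convolvable f -> convolvable g -> convolvable (fun x => f x - g x).
Proof.
move=> cf cg y; apply: (@sub_finite_set _ _
  ([set x | (x <= y)%O && (f x != 0)] `|` [set x | (x <= y)%O && (g x != 0)])).
  move=> x /= /andP[-> /=]; have [->|//] := eqVneq (f x) 0; last by left.
  by rewrite sub0r oppr_eq0; right.
by rewrite finite_setU; split; [exact: cf | exact: cg].
Qed.

Lemma mobius_inversionB f g : convolvable f -> convolvable g ->
  mobius_inversion (fun x => f x - g x) =
  (fun y => mobius_inversion f y - mobius_inversion g y).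
Proof.
move=> cf cg; apply/funext => y.
(* The three sums may have different supports, so all are first moved to one finite set containing
   the supports of [f] and [g] below [y]; there they subtract term by term. *)
pose S := [set x | (x <= y)%O && (f x != 0)] `|` [set x | (x <= y)%O && (g x != 0)].
have Sfin : finite_set S by rewrite finite_setU; split; [exact: cf | exact: cg].
have SE h : (forall x, (x <= y)%O -> ~ S x -> h x = 0) ->
    mobius_inversion h y = \sum_(x \in S) h x * mobius x y.
  move=> h0; rewrite [RHS](@fsbig_widen _ _ _ _ _ [set x | (x <= y)%O])//.
    by move=> x /= [] /andP[].
  by move=> x /= [xy Sx]; rewrite h0// mul0r.
have S0 x : (x <= y)%O -> ~ S x -> f x = 0 /\ g x = 0.
  move=> xy /not_orP[/= fx gx]; rewrite xy /= in fx gx.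
  by split; apply/eqP; apply: contraT; [move/fx | move/gx].
rewrite !SE; last 3 first.
- by move=> x xy /(S0 _ xy)[].
- by move=> x xy /(S0 _ xy)[].
- by move=> x xy /(S0 _ xy)[-> ->]; rewrite subrr.
rewrite !fsbig_finite//= -sumrB; apply: eq_bigr => x _; exact: mulrBl.
Qed.

Lemma mobius_inversion_eq0 f : convolvable f ->
  (forall y, mobius_inversion f y = 0) -> forall y, f y = 0.
Proof.
move=> cf mf0 y; pose S z := [set x | (x <= z)%O && (f x != 0)].
(* Strong induction on the size of the support of [f] below [y]. If [f y] is nonzero, any [x < y]
   has a strictly smaller such support, since [y] itself drops out. *)
have [n] := ubnP #|` fset_set (S y)|; elim: n y => // n IHn y.
rewrite ltnS => leSn; apply/eqP; apply: contraT => fy0.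
have below x : (x < y)%O -> f x = 0.
  move=> xy; apply: IHn; apply: leq_trans leSn; apply: fproper_ltn_card.
  rewrite fproperE; apply/andP; split.
    apply/fsubsetP => z; rewrite !in_fset_set//; try exact: cf.
    move=> /set_mem /= /andP[zx fz]; apply/mem_set.
    by rewrite /S /= fz (le_trans zx (ltW xy)).
  apply/negP => /fsubsetP/(_ y); rewrite !in_fset_set//; try exact: cf.
  have yS : y \in S y by apply/mem_set; rewrite /S /= lexx.
  by move=> /(_ yS)/set_mem /= /andP[/(lt_le_trans xy)]; rewrite ltxx.
case/negP: fy0; rewrite -[X in _ == X](mf0 y) /mobius_inversion -(@fsbig_widen _ _ _ _ [set y]).
- by rewrite fsbig_set1 mobius_refl mulr1.
- by move=> z /= ->.
- move=> z /= [zy /eqP zNy]; rewrite below ?mul0r//.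
  by rewrite lt_neqAle zNy zy.
Qed.

Lemma mobius_inversion_inj f g : convolvable f -> convolvable g ->
  mobius_inversion f = mobius_inversion g -> f = g.
Proof.
move=> cf cg fg; apply/funext => y; apply/eqP; rewrite -subr_eq0; apply/eqP.
apply: (mobius_inversion_eq0 (fun x => f x - g x)) => [|z].
  exact: convolvableB.
by rewrite mobius_inversionB// fg subrr.
Qed.

Lemma mobius_inversion_indic_sum (D : set T) f : (forall x, ~ D x -> f x = 0) ->
  mobius_inversion f =
  (fun y => \sum_(x \in D) f x * mobius_inversion (indic x) y).
Proof.
move=> f0; apply/funext => y; rewrite {1}/mobius_inversion.
(* Both sums live on the part of [D] below [y]: [f] vanishes off [D], and [mobius x y] vanishes
   unless [x <= y]. *)
transitivity (\sum_(x \in D `&` [set x | (x <= y)%O]) f x * mobius x y).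
  rewrite [RHS](@fsbig_widen _ _ _ _ _ [set x | (x <= y)%O])//.
  by move=> x /= [xy /not_andP[Dx|//]]; rewrite f0// mul0r.
rewrite [LHS](@fsbig_widen _ _ _ _ _ D)//.
  by apply: eq_fsbigr => x _; rewrite mobius_inversion_indic.
by move=> x /= [Dx /not_andP[//|/negP xy]]; rewrite mobius_nle ?mulr0.
Qed.

(** Coefficients and values of [f] are the same data, and local finiteness of the family translates
    into convolvability of [f]. *)
Lemma linear_combination_indicP (D : set T) (h : T -> rat) :
  linear_combination D (fun x => mobius_inversion (indic x)) h <->
  exists f, [/\ convolvable f, forall x, ~ D x -> f x = 0
              & h = mobius_inversion f].
Proof.
split=> [[c [cfin ->]]|[f [cf f0 ->]]].
  have c0 x : ~ D x -> (if x \in D then c x else 0) = 0.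
    by move=> Dx; rewrite memNset.
  (* [c] is arbitrary off [D], hence the extension by zero. *)
  exists (fun x => if x \in D then c x else 0); split=> //.
    (* The term of index [x] does not vanish at [x], as [mu(x, x) = 1]. *)
    move=> y; apply: sub_finite_set (cfin y) => x /= /andP[xy].
    have [/set_mem Dx cx|_] := boolP (x \in D); last by rewrite eqxx.
    split=> //; exists x => //.
    by rewrite mobius_inversion_indic mobius_refl mulr1.
  rewrite (mobius_inversion_indic_sum D)//; apply/funext => y.
  by apply: eq_fsbigr => x ->.
exists f; split; last exact: mobius_inversion_indic_sum.
move=> y; apply: sub_finite_set (cf y) => x /= [Dx [z zy]].
(* A term of index [x] that is nonzero at some [z <= y] has [x <= z], so [x] is in the support of
   [f] below [y]. *)
rewrite mobius_inversion_indic mulf_eq0 negb_or => /andP[-> mxz].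
rewrite andbT; apply: le_trans zy; apply: contraNT mxz => xz.
by rewrite mobius_nle.
Qed.

End MobiusInversion.

Theorem theorem7 (k : fieldType) (d : Order.disp_t) (P : porderType d)
    (I J : set (poset_interval P)) (M N : pmodule k P) :
  I `<=` J ->
  gri_convolvable J M ->
  gri_convolvable J N ->
  (forall A : J, I (val A) -> gri M A = gri N A) <->
  linear_combination [set A : J | ~ I (val A)]
    (fun A : J => mobius_inversion (indic A))
    (fun B : J => dgm M B - dgm N B).
Proof.
move=> _ [_ cM] [_ cN].
have cMN := convolvableB _ _ cM cN.
rewrite -(mobius_inversionB _ _ cM cN) linear_combination_indicP.
(* Forward, the difference of the rank invariants itself serves as [f]; backward, injectivity forces
   [f] to be that difference. *)
split=> [MN|[f [cf f0 /(mobius_inversion_inj _ _ cMN cf) fE]] A IA].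
  exists (fun B => griQ M B - griQ N B); split=> // A /= /contrapT IA.
  by rewrite /griQ MN// subrr.
apply/eqP; rewrite -(eqr_nat rat) -subr_eq0; apply/eqP.
by rewrite -[LHS]/((fun B => griQ M B - griQ N B) A) fE f0//= => /(_ IA).
Qed.
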